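(* Let $(\overline{x},\overline{\lambda})$ be a KKT point of the unperturbed problem, i.e. $\nabla f(\overline{x})+\nabla g(\overline{x})\overline{\lambda}=0$ and $\overline{\lambda}\in\mathcal{N}_{\mathcal{K}}(g(\overline{x}))$. Write $\overline{\eta}:=\nabla f(\overline{x})$ and $\overline{y}:=g(\overline{x})$. For $\eta\in\mathbb{X}$ define $\mathcal{H}(\eta):=\{\lambda\in\mathbb{Y}\mid\eta+\nabla g(\overline{x})\lambda=0\}$ and $\mathcal{E}(\eta):=\mathcal{H}(\eta)\cap\mathcal{N}_{\mathcal{K}}(\overline{y})$, and for $(\eta,y)\in\mathbb{X}\times\mathbb{Y}$ define $\mathcal{G}_{\overline{x}}(\eta,y):=\{\lambda\in\mathbb{Y}\mid\eta+\nabla g(\overline{x})\lambda=0,\ y-\Pi_{\mathcal{K}}(y+\lambda)=0\}$. Then the following statements hold. (a) The multifunction $\mathcal{G}_{\overline{x}}$ is calm at $(\overline{\eta},\overline{y})$ for $\overline{\lambda}$ provided that $\mathcal{E}$ is calm at $\overline{\eta}$ for $\overline{\lambda}$. (b) $\mathcal{E}$ is calm at $\overline{\eta}$ for $\overline{\lambda}$ if there exist $\delta>0$ and $\gamma>0$ such that for any $\lambda\in\mathbb{B}_{\delta}(\overline{\lambda})$, $${\rm dist}(\lambda,\mathcal{E}(\overline{\eta}))\le\gamma\max\big\{{\rm dist}(\lambda,\mathcal{N}_{\mathcal{K}}(\overline{y})),\ {\rm dist}(\lambda,\mathcal{H}(\overline{\eta}))\big\};$$ and this last condition is in particular implied by the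 condition ${\rm ri}(\mathcal{N}_{\mathcal{K}}(\overline{y}))\cap\mathcal{H}(\overline{\eta})\neq\emptyset$.
   Context: Setting. $\mathbb{X},\mathbb{Y}$ are finite dimensional real vector spaces with inner product $\langle\cdot,\cdot\rangle$ and induced norm $\|\cdot\|$; $f:\mathbb{X}\to\mathbb{R}$ and $g:\mathbb{X}\to\mathbb{Y}$ are twice continuously differentiable; $\mathcal{K}\subseteq\mathbb{Y}$ is a nonempty closed convex set which is $C^2$-cone reducible: at every $\overline{y}\in\mathcal{K}$ there exist an open neighborhood $\mathcal{Y}$ of $\overline{y}$, a pointed closed convex cone $D$ in a finite dimensional space $\mathbb{Z}$, and a twice continuously differentiable $\Xi:\mathcal{Y}\to\mathbb{Z}$ with $\Xi(\overline{y})=0$, $\Xi'(\overline{y}):\mathbb{Y}\to\mathbb{Z}$ onto, and $\mathcal{K}\cap\mathcal{Y}=\{y\in\mathcal{Y}\mid\Xi(y)\in D\}$. The unperturbed problem is $\min_{x\in\mathbb{X}}\{f(x) : g(x)\in\mathcal{K}\}$. Notation. $\nabla h(x)$ is the adjoint of the derivative $h'(x)$; $\mathcal{N}_{\mathcal{K}}$ is the normal cone of convex analysis; $\Pi_{\mathcal{K}}$ is the projection onto $\mathcal{K}$; ${\rm ri}$ denotes relative interior; $\mathbb{B}_{\delta}(z)$ is the closed ball of radius $\delta$ centered at $z$. Calmness. A multifunction $\mathcal{F}:\mathbb{Z}\rightrightarrows\mathbb{W}$ is calm at $\overline{z}$ for $\overline{w}\in\mathcal{F}(\overline{z})$ if there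 exist $\kappa,\varepsilon,\delta>0$ such that $\mathcal{F}(z)\cap\mathbb{B}_{\delta}(\overline{w})\subseteq\mathcal{F}(\overline{z})+\kappa\|z-\overline{z}\|\mathbb{B}_{\mathbb{W}}$ for all $z\in\mathbb{B}_{\varepsilon}(\overline{z})$, where $\mathbb{B}_{\mathbb{W}}$ is the closed unit ball of $\mathbb{W}$. *)

(* Defs.v *)
From HB Require Import structures.
From mathcomp Require Import all_boot all_order all_algebra sesquilinear.
From mathcomp Require Import all_classical all_reals all_analysis.

Set Implicit Arguments.
Unset Strict Implicit.
Unset Printing Implicit Defensive.

Import Order.TTheory GRing.Theory Num.Theory.
Import numFieldNormedType.Exports.

Local Open Scope classical_set_scope.
Local Open Scope ring_scope.

(* Finite dimensional real inner product spaces: finite dimension is carried by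
   the [Vector] structure, and the norm (hence the topology, the balls and the
   differentials) is the one induced by the inner product. *)
HB.mixin Record NormedModule_isEuclidean (R : realType) V
    of NormedModule R V & Vector R V := {
  inner : {dot V for idfun};
  sqr_norm_inner : forall v : V, `|v| ^+ 2 = inner v v
}.

#[short(type="euclideanType")]
HB.structure Definition Euclidean (R : realType) :=
  {V of NormedModule_isEuclidean R V & NormedModule R V & Vector R V}.

Section real_line.
Variable R : realType.

Definition mulr_form (x y : R^o) : R := x * y.

Let mulr_form_linearl (y : R^o) : linear_for *%R (mulr_form ^~ y).
Proof. by move=> a u v; rewrite /mulr_form mulrDl [a * _]mulrA. Qed.

Let mulr_form_linearr (x : R^o) : linear_for *%R (mulr_form x).
Proof. by move=> a u v; rewrite /mulr_form mulrDr /= [a * _]mulrCA. Qed.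

HB.instance Definition _ :=
  bilinear_isBilinear.Build R R^o R^o R *%R (idfun \; *%R) mulr_form
    (conj mulr_form_linearl mulr_form_linearr).

Let mulr_form_sym (x y : R^o) :
  mulr_form x y = (-1) ^+ false * idfun (mulr_form y x).
Proof. by rewrite /mulr_form expr0 mul1r mulrC. Qed.

HB.instance Definition _ :=
  isHermitianSesquilinear.Build R R^o false idfun mulr_form mulr_form_sym.

Let mulr_form_gt0 (x : R^o) : x != 0 -> 0 < mulr_form x x.
Proof. by move=> x0; rewrite /mulr_form -expr2 exprn_even_gt0. Qed.

HB.instance Definition _ :=
  isDotProduct.Build R R^o mulr_form mulr_form_gt0.

Let mulr_form_norm (x : R^o) : `|x| ^+ 2 = mulr_form x x.
Proof. by rewrite real_normK ?num_real// expr2. Qed.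

HB.instance Definition _ :=
  NormedModule_isEuclidean.Build R R^o mulr_form_norm.

End real_line.

Section differential_notions.
Variable R : realType.

(* Meant for [U] open. In finite dimension the map z |-> 'd h z is C^1 for the
   operator norm iff all its evaluations z |-> 'd h z v are C^1. *)
Definition twice_continuously_differentiable (V W : normedModType R)
    (U : set V) (h : V -> W) : Prop :=
  forall x, U x ->
    [/\ differentiable h x,
        forall v, differentiable (fun z => 'd h z v) x &
        forall v u, {for x, continuous
          (fun z => 'd (fun t => 'd h t v) z u)}].

(* The choice is the Riesz representative, which exists and is unique when [A]
   is linear. *)
Definition adjoint (X Y : euclideanType R) (A : X -> Y) (y : Y) : X :=
  xget 0 [set u | forall v, inner u v = inner y (A v)].

Definition nabla (X Y : euclideanType R) (h : X -> Y) (x : X) : Y -> X :=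
  adjoint ('d h x).

(* The adjoint of f'(x) : X -> R is a map R -> X, identified with its value at 1. *)
Definition grad (X : euclideanType R) (f : X -> R^o) (x : X) : X :=
  nabla f x (1 : R^o).

End differential_notions.

Definition pointed_closed_convex_cone (R : realType) (Z : euclideanType R)
    (D : set Z) : Prop :=
  [/\ forall (t : R) d, 0 <= t -> D d -> D (t *: d),
      convex_set D, closed D & D `&` [set - d | d in D] = [set 0]].

Section convex_analysis.
Variables (R : realType) (Y : euclideanType R).
Implicit Types (A K : set Y) (x y z : Y).

(* Empty at the points outside of K. *)
Definition normal_cone K y : set Y :=
  [set l | K y /\ forall z, K z -> inner l (z - y) <= 0].

Definition proj K y : Y :=
  xget 0 [set p | K p /\ forall q, K q -> `|y - p| <= `|y - q|].

(* Only meaningful for nonempty A: [inf set0 = 0]. *)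
Definition dist y A : R := inf [set `|y - a| | a in A].

Definition affine_set A : Prop :=
  forall x y (t : R), A x -> A y -> A ((1 - t) *: x + t *: y).

Definition affine_hull A : set Y := smallest affine_set A.

Definition rel_interior A : set Y :=
  [set x | A x /\ exists2 e : R, 0 < e & ball x e `&` affine_hull A `<=` A].

Definition C2_cone_reducible_at K y : Prop :=
  exists (U : set Y) (Z : euclideanType R) (D : set Z) (Xi : Y -> Z),
    [/\ open U /\ U y,
        pointed_closed_convex_cone D,
        twice_continuously_differentiable U Xi,
        Xi y = 0 /\ range ('d Xi y) = setT &
        K `&` U = [set z | U z /\ D (Xi z)]].

Definition C2_cone_reducible K : Prop :=
  forall y, K y -> C2_cone_reducible_at K y.

End convex_analysis.

(* [F zb wb] is part of the definition. For Z a product, the library norm is the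
   max norm; calmness is unaffected by the choice of an equivalent norm. *)
Definition calm (R : realType) (Z W : normedModType R) (F : Z -> set W)
    (zb : Z) (wb : W) : Prop :=
  F zb wb /\
  exists kappa eps delta : R, [/\ 0 < kappa, 0 < eps, 0 < delta &
    forall z, closed_ball zb eps z ->
      F z `&` closed_ball wb delta `<=`
      [set u + (kappa * `|z - zb|) *: b | u in F zb & b in closed_ball 0 1]].

Section multipliers.
Variables (R : realType) (X Y : euclideanType R).
Variables (f : X -> R^o) (g : X -> Y) (K : set Y) (xb : X).

Definition KKT_point (lb : Y) : Prop :=
  grad f xb + nabla g xb lb = 0 /\ normal_cone K (g xb) lb.

Definition Hmap (eta : X) : set Y := [set l | eta + nabla g xb l = 0].

Definition Emap (eta : X) : set Y := Hmap eta `&` normal_cone K (g xb).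

Definition Gmap (p : X * Y) : set Y :=
  [set l | p.1 + nabla g xb l = 0 /\ p.2 - proj K (p.2 + l) = 0].

Definition dist_bound (eta : X) (lb : Y) : Prop :=
  exists delta gamma : R, [/\ 0 < delta, 0 < gamma &
    forall l, closed_ball lb delta l ->
      dist l (Emap eta) <=
      gamma * Num.max (dist l (normal_cone K (g xb))) (dist l (Hmap eta))].

End multipliers.

(* Main.v *)
Require Import Defs.
From HB Require Import structures.
From mathcomp Require Import all_boot all_order all_algebra sesquilinear.
From mathcomp Require Import all_classical all_reals all_analysis.
From mathcomp Require Import ring lra.
Import Order.TTheory GRing.Theory Num.Theory.
Import numFieldNormedType.Exports.
Local Open Scope classical_set_scope.
Local Open Scope ring_scope.

(* Write N(y) for the normal cone of K at y and A for nabla g xb.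
   (a) N is calm as a multifunction at yb: if l is in N(y) with y near yb, then
   l is approximately Xi'(z)^* mu with z near y and mu in the polar of D, so
   l' := Xi'(yb)^* mu lies in N(yb) and |l - l'| = O(|y - yb|), the bound on mu
   coming from the surjectivity of Xi'(yb).  Calmness of E, applied to l' and the
   perturbation - A l', transfers to l.  The exact chain rule N(y) = Xi'(y)^* N_D
   is not needed: the approximate multiplier mu comes from penalizing the
   constraint Xi(z) in D, which avoids the implicit function theorem.
   (b) For l in E(eta), dist(l, N(yb)) = 0 and dist(l, H(etab)) = O(|eta - etab|)
   since A has a bounded right inverse on its range.  If m0 is in both ri N(yb)
   and H(etab), a point n of N(yb) close to l is first moved within aff N(yb) to a
   point n - v of H(etab), which is then contracted slightly towards m0, by a
   factor proportional to |v|, so as to re-enter N(yb). *)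

(** * Inner products and linear maps in finite dimension *)

Lemma innerC {R : realType} {X : euclideanType R} (u v : X) :
  inner u v = inner v u.
Proof. by have := @hermC R false idfun X inner u v; rewrite expr0 mul1r. Qed.

Lemma innerPl {R : realType} {X : euclideanType R} (w : X) (a : R) (u v : X) :
  inner (a *: u + v) w = a * inner u w + inner v w.
Proof. exact: linearPl. Qed.

Lemma innerDl {R : realType} {X : euclideanType R} (u v w : X) :
  inner (u + v) w = inner u w + inner v w.
Proof. exact: linearDl. Qed.

Lemma innerNl {R : realType} {X : euclideanType R} (u w : X) :
  inner (- u) w = - inner u w.
Proof. exact: linearNl. Qed.

Lemma innerZl {R : realType} {X : euclideanType R} (a : R) (u w : X) :
  inner (a *: u) w = a * inner u w.
Proof. exact: linearZl_LR. Qed.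

Lemma inner0l {R : realType} {X : euclideanType R} (w : X) : inner 0 w = 0 :> R.
Proof. exact: linear0l. Qed.

Lemma innerDr {R : realType} {X : euclideanType R} (u v w : X) :
  inner w (u + v) = inner w u + inner w v.
Proof. exact: linearDr. Qed.

Lemma innerNr {R : realType} {X : euclideanType R} (u w : X) :
  inner w (- u) = - inner w u.
Proof. exact: linearNr. Qed.

Lemma innerZr {R : realType} {X : euclideanType R} (a : R) (u w : X) :
  inner w (a *: u) = a * inner w u.
Proof. by rewrite innerC innerZl innerC. Qed.

Lemma inner0r {R : realType} {X : euclideanType R} (w : X) : inner w 0 = 0 :> R.
Proof. exact: linear0r. Qed.

Definition innerE := (@innerDl, @innerDr, @innerNl, @innerNr, @innerZl, @innerZr,
  @inner0l, @inner0r).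

Lemma normD_sqr {R : realType} {X : euclideanType R} (u v : X) :
  `|u + v| ^+ 2 = `|u| ^+ 2 + 2 * inner u v + `|v| ^+ 2.
Proof. by rewrite !sqr_norm_inner !innerE (innerC v u); ring. Qed.

(** Cauchy-Schwarz: expand the squared norm of [|v| u - |u| v] and divide by twice [|u| |v|]. *)
Lemma inner_le_norm {R : realType} {X : euclideanType R} (u v : X) :
  inner u v <= `|u| * `|v|.
Proof.
have := sqr_ge0 `| `|v| *: u - `|u| *: v|.
rewrite normD_sqr normrN !normrZ !normr_id !innerE.
have [->|u0] := eqVneq u 0; first by rewrite inner0l normr0 mul0r.
have [->|v0] := eqVneq v 0; first by rewrite inner0r normr0 mulr0.
have p0 : 0 < `|u| * `|v| by rewrite mulr_gt0 ?normr_gt0.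
move=> h; rewrite -subr_ge0 -(pmulr_rge0 _ p0); nra.
Qed.

Lemma normr_inner_le {R : realType} {X : euclideanType R} (u v : X) :
  `|inner u v| <= `|u| * `|v|.
Proof.
by rewrite ler_norml inner_le_norm andbT lerNl -innerNl -(normrN u) inner_le_norm.
Qed.

(** This also serves to prove vector identities: testing against an arbitrary vector turns them into
    scalar ones, within reach of [ring]. *)
Lemma inner_inj {R : realType} {X : euclideanType R} (u w : X) :
  (forall v, inner u v = inner w v) -> u = w.
Proof.
move=> h; apply/eqP; rewrite -subr_eq0 -normr_eq0 -sqrf_eq0 sqr_norm_inner.
by rewrite innerDl innerNl h subrr.
Qed.

Lemma linear_coord {R : realType} {X : euclideanType R} {W : lmodType R}
    (h : X -> W) : linear h ->
  forall x, h x = \sum_i coord (vbasis {:X}) i x *: h (vbasis {:X})`_i.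
Proof.
move=> lh x.
pose H : {linear X -> W} := HB.pack h (GRing.isLinear.Build _ _ _ _ h lh).
rewrite -[h]/(H : X -> W) {1}(coord_vbasis (memvf x)) linear_sum.
by apply: eq_bigr => i _; rewrite linearZ.
Qed.

Lemma inner_linear {R : realType} {X : euclideanType R} (u : X) :
  linear (fun v => inner u v : R^o).
Proof. by move=> a v w; rewrite innerDr innerZr. Qed.

(** Taking inner products with a basis is an injective linear map from [X] to row vectors of length
    [\dim {:X}], hence onto by counting dimensions. *)
Lemma riesz {R : realType} {X : euclideanType R} (phi : X -> R^o) :
  linear phi -> exists u : X, forall v, inner u v = phi v.
Proof.
move=> lphi; pose n := \dim {:X}; pose b := vbasis {:X}.
pose T (u : X) : 'rV[R]_n := \row_i inner u b`_i.
have lT : linear T by move=> a u v; apply/rowP => i; rewrite !mxE innerPl.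
pose TL : {linear X -> 'rV[R]_n} := HB.pack T (GRing.isLinear.Build _ _ _ _ T lT).
have kerT : lker (linfun TL) == 0%VS.
  rewrite -subv0; apply/subvP => u; rewrite memv_ker lfunE /= => /eqP Tu.
  rewrite memv0 -normr_eq0 -sqrf_eq0 sqr_norm_inner (linear_coord _ (inner_linear u)).
  rewrite big1// => i _; have := congr1 (fun M : 'rV_n => M 0 i) Tu.
  by rewrite !mxE => ->; exact: scaler0.
have imT : limg (linfun TL) = fullv.
  apply/eqP; rewrite eqEdim subvf/= limg_dim_eq; last first.
    by rewrite (eqP kerT) capv0.
  by rewrite !dimvf /dim /= mul1n /n dimvf.
have /memv_imgP[u _ Tu] : (\row_i phi b`_i : 'rV[R]_n) \in limg (linfun TL).
  by rewrite imT memvf.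
exists u => v; rewrite (linear_coord _ (inner_linear u)) (linear_coord _ lphi).
apply: eq_bigr => i _; have := congr1 (fun M : 'rV_n => M 0 i) Tu.
by rewrite lfunE !mxE => ->.
Qed.

(** Each coordinate is an inner product with a Riesz vector, so Cauchy-Schwarz bounds it. *)
Lemma linear_bound {R : realType} {X : euclideanType R} {W : normedModType R}
    (h : X -> W) : linear h ->
  exists2 C : R, 0 < C & forall x, `|h x| <= C * `|x|.
Proof.
move=> lh.
have /choice[c hc] i : exists u : X, forall v,
    inner u v = (coord (vbasis {:X}) i v : R^o).
  by apply: riesz => a u v; rewrite linearP.
exists (1 + \sum_i `|c i| * `|h (vbasis {:X})`_i|) => [|x].
  by rewrite ltr_pwDl// sumr_ge0// => i _; rewrite mulr_ge0.
rewrite (linear_coord _ lh) (le_trans (ler_norm_sum _ _ _))//.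
rewrite mulrDl mul1r ler_wpDl// mulr_suml ler_sum// => i _.
by rewrite normrZ -hc mulrAC ler_wpM2r// normr_inner_le.
Qed.

(** * Compactness and projections *)

Lemma lipschitz_bound_continuous {R : realType} {V W : normedModType R}
    (h : V -> W) (C : R) :
  (forall x y, `|h x - h y| <= C * `|x - y|) -> continuous h.
Proof.
move=> hC x; apply/cvgrPdist_le => e e0.
have C0 : 0 < `|C| + 1 by rewrite ltr_wpDl.
near=> y; rewrite (le_trans (hC _ _))//.
have : `|x - y| <= e / (`|C| + 1).
  by near: y; apply: cvgr_dist_le => //; rewrite divr_gt0.
rewrite ler_pdivlMr// mulrC; apply: le_trans; rewrite ler_wpM2r//.
by rewrite (le_trans (ler_norm _))// lerDl.
Unshelve. all: by end_near. Qed.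

Lemma linear_bound_continuous {R : realType} {X : euclideanType R}
    {W : normedModType R} (h : X -> W) : linear h -> continuous h.
Proof.
move=> lh; have [C _ hC] := linear_bound _ lh.
apply: (@lipschitz_bound_continuous _ _ _ _ C) => x y.
pose H : {linear X -> W} := HB.pack h (GRing.isLinear.Build _ _ _ _ h lh).
by rewrite -[h]/(H : X -> W) -linearB.
Qed.

Lemma inner_continuous {R : realType} {X : euclideanType R} (u : X) :
  continuous (fun v => inner u v : R^o).
Proof. exact: linear_bound_continuous (inner_linear u). Qed.

(** The ball is a closed part of the image of a compact box of coordinates. *)
Lemma compact_closed_ball_ {R : realType} {X : euclideanType R} (x : X) (r : R) :
  compact [set y | `|x - y| <= r].
Proof.
pose n := \dim {:X}; pose b := vbasis {:X}.
pose phi (M : 'rV[R]_n) : X := x + \sum_(i < n) M ord0 i *: b`_i.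
have cphi : continuous phi.
  have csum (M : 'rV[R]_n) : (\sum_(i < n) M' ord0 i *: b`_i) @[M' --> M] -->
      \sum_(i < n) M ord0 i *: b`_i.
    apply: (@cvg_big _ _ _ _ _ (@add_continuous X)) => i _.
    exact: (cvgZ (@coord_continuous _ _ _ ord0 i M) (cvg_cst _)).
  by move=> M; exact: cvgD (cvg_cst x) (csum M).
have coordB i : exists2 C : R, 0 < C &
    forall u : X, `|coord b i u : R^o| <= C * `|u|.
  by apply: linear_bound => a u v; rewrite linearP.
have /choice[C hC] i : exists C : R, 0 < C /\
    forall u : X, `|coord b i u : R^o| <= C * `|u|.
  by have [C C0 hC] := coordB i; exists C.
pose box := [set M : 'rV[R]_n | forall i, `[- (C i * r), C i * r]%classic (M ord0 i)].
have cbox : compact (phi @` box).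
  apply: (continuous_compact (continuous_subspaceT cphi)).
  exact: (@rV_compact _ _ (fun i => `[- (C i * r), C i * r]%classic)
    (fun i => @segment_compact _ _ _)).
have clB : closed [set y | `|x - y| <= r] by exact: closed_closed_ball_.
apply: (subclosed_compact clB cbox) => y /= xy.
exists (\row_i coord b i (y - x)) => /= [i|].
  rewrite mxE; rewrite set_itvE /= -ler_norml; have [C0 h] := hC i.
  by rewrite (le_trans (h _))// distrC ler_pM2l.
rewrite /phi; under eq_bigr do rewrite mxE.
by rewrite -(coord_vbasis (memvf (y - x))) addrC subrK.
Qed.

Lemma convex_setP {R : realType} {X : euclideanType R} (K : set X) (x y : X)
    (t : R) :
  convex_set K -> K x -> K y -> 0 <= t -> t <= 1 -> K (x + t *: (y - x)).
Proof.
move=> cK Kx Ky t0 t1.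
have t01 : Itv.spec (@Itv.num_sem R) (Itv.Real `[0%Z, 1%Z]) t.
  by rewrite /= /Itv.num_sem /= realE t0/= in_itv/= t0 t1.
have := cK y x (Itv.mk t01); rewrite !inE => /(_ Ky Kx).
rewrite /conv /=; congr K.
by rewrite scalerBr scalerBl scale1r addrCA addrA.
Qed.

Lemma nearest_point {R : realType} {X : euclideanType R} (K : set X) (y : X) :
  K !=set0 -> closed K ->
  exists p, K p /\ forall q, K q -> `|y - p| <= `|y - q|.
Proof.
move=> [k0 Kk0] cK.
(* Only points of [K] no farther from [y] than [k0] compete, and these form a compact set. *)
have [||p] := @compact_EVT_min X R (fun q => `|y - q|)
    ([set q | `|y - q| <= `|y - k0|] `&` K) _ (compact_closedI (compact_closed_ball_ y _) cK).
- by exists k0; split => /=.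
- apply: continuous_subspaceT.
  apply: (@lipschitz_bound_continuous _ _ R^o _ 1) => u v.
  by rewrite mul1r (le_trans (ler_dist_dist _ _))// opprB addrC addrA subrK distrC.
rewrite inE => -[/= pk Kp] hp; exists p; split => // q Kq.
have [qk|/ltW qk] := leP `|y - q| `|y - k0|; last exact: le_trans qk.
by apply: hp; rewrite inE.
Qed.

Lemma nearest_point_le0 {R : realType} {X : euclideanType R} (K : set X)
    (y p q : X) : convex_set K -> K p ->
  (forall q, K q -> `|y - p| <= `|y - q|) -> K q -> inner (y - p) (q - p) <= 0.
Proof.
move=> cK Kp hp Kq; rewrite leNgt; apply/negP => s0.
set s := inner _ _ in s0; set d := `|q - p| ^+ 2.
have d0 : 0 <= d by rewrite exprn_ge0.
have step t : 0 < t -> t <= 1 -> 2 * s <= t * d.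
  move=> t0 t1; have := hp _ (convex_setP _ _ _ _ cK Kp Kq (ltW t0) t1).
  move/(lerXn2r 2 (normr_ge0 _) (normr_ge0 _)).
  rewrite opprD addrA [X in _ <= X]normD_sqr.
  rewrite innerNr innerZr normrN normrZ exprMn real_normK ?num_real// -/s -/d.
  by move=> h; rewrite -subr_ge0 -(pmulr_rge0 _ t0); nra.
have sd : 0 < s + d by rewrite ltr_pwDl.
(* This [t] lies in (0, 1] even when [d = 0], and gives [2 * (s + d) <= d], which is absurd. *)
have := step (s / (s + d)); rewrite divr_gt0// ler_pdivrMr// mul1r lerDl d0.
move=> /(_ isT isT); rewrite mulrAC ler_pdivlMr//; nra.
Qed.

(* Defs.proj must be qualified: the library's proj shadows it. *)
Lemma projP {R : realType} {X : euclideanType R} (K : set X) (y : X) :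
  K !=set0 -> closed K ->
  K (Defs.proj K y) /\ forall q, K q -> `|y - Defs.proj K y| <= `|y - q|.
Proof.
move=> K0 cK; have [p hp] := nearest_point _ y K0 cK.
by rewrite /Defs.proj; case: xgetP => [_ _ //|/(_ p)].
Qed.

(** Translates the second equation of [Gmap] into normality. Forwards, expanding
    [|y + l - p| <= |l|] and using [inner l (p - y) <= 0] forces [p = y]; backwards, it is the
    variational inequality of the projection. *)
Lemma normal_cone_proj {R : realType} {X : euclideanType R} (K : set X)
    (y l : X) : K !=set0 -> closed K -> convex_set K ->
  normal_cone K y l <-> y = Defs.proj K (y + l).
Proof.
move=> K0 cK cvK; have [Kp hp] := projP _ (y + l) K0 cK; split.
  move=> [Ky hl]; have := hl _ Kp; have := hp _ Ky.
  move/(lerXn2r 2 (normr_ge0 _) (normr_ge0 _)).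
  set p := Defs.proj K _; rewrite (addrAC y l (- y)) subrr add0r (addrAC y l).
  rewrite [X in X <= _]normD_sqr innerC -(opprB p y) innerNr normrN => h1 h2.
  apply/eqP; rewrite eq_sym -subr_eq0 -normr_eq0 -sqrf_eq0 eq_le exprn_ge0// andbT.
  by lra.
move=> yp; rewrite -yp in Kp hp; split=> // z Kz.
by have := nearest_point_le0 _ _ _ _ cvK Kp hp Kz; rewrite addrAC subrr add0r.
Qed.

(** * Adjoints and bounded linear selections *)

Lemma adjointE {R : realType} {X Y : euclideanType R} (A : X -> Y) (y : Y)
    (v : X) : linear A -> inner (adjoint A y) v = inner y (A v).
Proof.
move=> lA; rewrite /adjoint.
have [|u hu] := riesz (fun v => inner y (A v) : R^o).
  by move=> a u w; rewrite lA innerDr innerZr.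
by case: xgetP => [w _ /(_ v)|/(_ u)].
Qed.

Lemma adjoint_linear {R : realType} {X Y : euclideanType R} (A : X -> Y) :
  linear A -> linear (adjoint A).
Proof.
move=> lA a u v; apply: inner_inj => w.
by rewrite innerPl !adjointE// innerPl.
Qed.

(** [L] is a subspace given as a set. A generalized inverse of [A] composed with the projection onto
    [L] selects preimages linearly, hence boundedly. *)
Lemma linear_bounded_section {R : realType} {X Y : euclideanType R}
    (A : X -> Y) (L : set X) : linear A -> L 0 ->
  (forall a x y, L x -> L y -> L (a *: x + y)) ->
  exists2 C : R, 0 < C & forall x, L x ->
    exists l, [/\ L l, A l = A x & `|l| <= C * `|A x|].
Proof.
move=> lA L0 LP.
(* A {vspace X} of maximal dimension inside L has the same elements as L. *)
pose P n := `[< exists V : {vspace X}, \dim V = n /\ forall v, v \in V -> L v >].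
have exP : exists n, P n.
  exists 0%N; apply/asboolP; exists 0%VS; rewrite dimv0; split => // v.
  by rewrite memv0 => /eqP ->.
have ubP n : P n -> (n <= \dim {:X})%N.
  by move=> /asboolP[V [<- _]]; rewrite dimvS ?subvf.
case: (ex_maxnP exP ubP) => n /asboolP[V [dV VL]] maxV.
have LV x : L x -> x \in V.
  move=> Lx; have : P (\dim (V + <[x]>)).
    apply/asboolP; exists (V + <[x]>)%VS; split => // v.
    move=> /memv_addP[w wV [_ /vlineP[a ->] ->]].
    by rewrite addrC; apply: LP => //; exact: VL.
  move=> /maxV; rewrite -dV => dle.
  have /eqP -> : V == (V + <[x]>)%VS by rewrite eqEdim addvSl.
  by rewrite (subvP (addvSr _ _))// memv_line.
pose AL : {linear X -> Y} := HB.pack A (GRing.isLinear.Build _ _ _ _ A lA).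
pose f := (linfun AL \o projv V)%VF.
have fE x : f x = A (projv V x) by rewrite comp_lfunE lfunE.
pose s u := projv V (f^-1%VF u).
have [|C C0 hC] := linear_bound s; first by move=> a u v; rewrite /s !linearP.
exists C => // x Lx; exists (s (A x)); split => //.
  by apply: VL; exact: memv_proj.
have -> : A x = f x by rewrite fE projv_id// LV.
by rewrite -fE -!comp_lfunE inv_lfun_def.
Qed.

(** * Distances, calmness and the relative interior condition *)

Lemma dist_le {R : realType} {X : euclideanType R} (A : set X) (y a : X) :
  A a -> Defs.dist y A <= `|y - a|.
Proof.
by move=> Aa; apply: ge_inf; [exists 0 => _ [b _ <-]|exists a].
Qed.

Lemma dist_lt_exists {R : realType} {X : euclideanType R} (A : set X) (y : X)
    (c : R) : A !=set0 -> Defs.dist y A < c -> exists2 a, A a & `|y - a| < c.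
Proof.
move=> [a0 Aa0] yc; rewrite -subr_gt0 in yc.
have [|_ [a Aa <-]] := inf_adherent yc (E := [set `|y - a| | a in A]).
  by split; [exists `|y - a0|, a0|exists 0 => _ [b _ <-]].
by move=> h; exists a => //; move: h; rewrite /Defs.dist; lra.
Qed.

(** Produces the form of the points in the definition of [calm]. For [c = 0] the convention
    [0^-1 = 0] yields [b = 0]. *)
Lemma ball_decomposition {R : realType} {V : normedModType R} (l u : V) (c : R) :
  `|l - u| <= c -> exists2 b, closed_ball 0 1 b & u + c *: b = l.
Proof.
move=> luc; have c0 : 0 <= c by exact: le_trans luc.
exists (c^-1 *: (l - u)).
  rewrite closed_ballE//= /closed_ball_ /= sub0r normrN normrZ.
  have [->|cn0] := eqVneq c 0; first by rewrite invr0 normr0 mul0r.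
  rewrite ger0_norm ?invr_ge0// mulrC ler_pdivrMr ?mul1r//.
  by rewrite lt_neqAle eq_sym cn0.
have [c0'|cn0] := eqVneq c 0; last by rewrite scalerA divff// scale1r addrC subrK.
move: luc; rewrite c0' scale0r addr0 normr_le0 subr_eq0 => /eqP ->.
by [].
Qed.

Lemma nabla_linear {R : realType} {X Y : euclideanType R} (g : X -> Y) (x : X) :
  linear (nabla g x).
Proof. by apply: adjoint_linear; exact: linearP. Qed.

Lemma linear_ops {R : realType} {V W : lmodType R} (h : V -> W) : linear h ->
  [/\ forall u v, h (u + v) = h u + h v, forall u, h (- u) = - h u &
      forall a u, h (a *: u) = a *: h u].
Proof.
move=> lh; pose H : {linear V -> W} := HB.pack h (GRing.isLinear.Build _ _ _ _ h lh).
by split; [exact: (linearD H)|exact: (linearN H)|exact: (linearZ_LR H)].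
Qed.

Lemma dist_bound_calm {R : realType} {X Y : euclideanType R} (g : X -> Y)
    (K : set Y) (x eta : X) (lb : Y) : Emap g K x eta lb ->
  dist_bound g K x eta lb -> calm (Emap g K x) eta lb.
Proof.
move=> Elb [d [c [d0 c0 hd]]]; split => //.
have lA := nabla_linear g x; have [AD AN _] := linear_ops _ lA.
set A := nabla g x in lA AD AN.
have [||C C0 hC] := linear_bounded_section A setT lA; [by []|by []|].
(* The extra 1 makes the distance estimate strict for [z] different from [eta], as extracting a
   point from an infimum requires. *)
exists (c * C + 1), 1, d; split => //; first by rewrite addr_gt0// mulr_gt0.
move=> z _ l [[Hl Nl] lball].
have [zE|zne] := eqVneq z eta.
  exists l; first by rewrite -zE.
  by exists 0; [exact: closed_ballxx|rewrite scaler0 addr0].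
(* A short correction: [A v = eta - z], so [l - v] solves the unperturbed equation, and [|v|] is at
   most [C * |eta - z|]. *)
have [v [_ Av vle]] := hC (l - lb) I.
have := addr0_eq Hl; have := addr0_eq Elb.1; rewrite -/A => Alb Al.
have AvE : A v = eta - z.
  by rewrite Av AD AN -Al -Alb opprK addrC.
have Hlv : Hmap g x eta (l - v).
  rewrite /Hmap /= -/A AD AN AvE -Al.
  by apply: inner_inj => w; rewrite !innerE; ring.
have dlt : Defs.dist l (Emap g K x eta) < (c * C + 1) * `|z - eta|.
  apply: (le_lt_trans (hd _ lball)).
  rewrite mulrDl mul1r ltr_pwDr ?normr_gt0 ?subr_eq0// -mulrA ler_pM2l//.
  rewrite ge_max; apply/andP; split.
    by rewrite (le_trans (dist_le _ _ _ Nl))// subrr normr0 mulr_ge0// ltW.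
  rewrite (le_trans (dist_le _ _ _ Hlv))// opprB addrC subrK.
  by rewrite (le_trans vle)// -Av AvE distrC.
have [|u Eu ul] := dist_lt_exists _ _ _ _ dlt; first by exists lb.
by have [b] := ball_decomposition _ _ _ (ltW ul); exists u => //; exists b.
Qed.

Lemma normal_cone_comb {R : realType} {Y : euclideanType R} (K : set Y)
    (y u v : Y) (a b : R) : 0 <= a -> 0 <= b ->
  normal_cone K y u -> normal_cone K y v -> normal_cone K y (a *: u + b *: v).
Proof.
move=> a0 b0 [Ky hu] [_ hv]; split => // z Kz.
by rewrite !innerE; have := hu _ Kz; have := hv _ Kz; nra.
Qed.

(** [a *: x + y] is the midpoint of [(2 * a) *: x] and [2 *: y], which lie on lines through 0. *)
Lemma affine_set_subspace {R : realType} {Y : euclideanType R} (L : set Y) :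
  affine_set L -> L 0 -> forall (a : R) x y, L x -> L y -> L (a *: x + y).
Proof.
move=> aL L0.
have LZ a x : L x -> L (a *: x).
  by move=> Lx; have := aL _ _ a L0 Lx; rewrite scaler0 add0r.
move=> a x y Lx Ly; have := aL _ _ 2^-1 (LZ (2 * a) _ Lx) (LZ 2 _ Ly).
rewrite !scalerA mulVf// scale1r; congr (L (_ *: _ + _)); lra.
Qed.

Lemma rel_interior_dist_bound {R : realType} {X Y : euclideanType R}
    (g : X -> Y) (K : set Y) (x eta : X) (lb : Y) : Emap g K x eta lb ->
  rel_interior (normal_cone K (g x)) `&` Hmap g x eta !=set0 ->
  dist_bound g K x eta lb.
Proof.
move=> Elb [m0 [[Nm0 [e e0 he]] Hm0]].
set N := normal_cone K (g x) in Nm0 he *.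
have lA := nabla_linear g x; have [AD AN AZ] := linear_ops _ lA.
have Ky : K (g x) by case: Nm0.
have N0 : N 0 by split=> // z _; rewrite inner0l.
have subL : N `<=` affine_hull N by exact: sub_gen_smallest.
have affL : affine_set (affine_hull N).
  move=> u v t hu hv B BN; have [affB _] := BN.
  by apply: affB; [exact: hu BN|exact: hv BN].
have LP := affine_set_subspace _ affL (subL _ N0).
set L := affine_hull N in LP subL he.
have [C C0 hC] := linear_bounded_section _ L lA (subL _ N0) LP.
have [CA CA0 hCA] := linear_bound _ lA.
rewrite /Hmap /= in Hm0; set A := nabla g x in lA AD AN AZ hC hCA Hm0.
(* With [n] and [h] within [m'] of [l], [|n - h| <= 2 * m']; applying [A] and then the bounded
   section gives [|v| <= k * m']. *)
pose k := 2 * (C * CA); have k0 : 0 < k by rewrite !mulr_gt0.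
(* A bound for [|n - q|], from [|q| <= |m0| + e] and [|n| <= |lb| + 3]. *)
pose M := `|m0| + e + `|lb| + 3.
have M0 : 0 < M by rewrite /M; have := normr_ge0 m0; have := normr_ge0 lb; lra.
pose c := 1 + 2 * k / e * M.
have c0 : 0 < c by rewrite /c addr_gt0// !mulr_gt0// invr_gt0.
exists 1, c; split => // l.
rewrite closed_ballE// /closed_ball_ /= distrC => llb.
set m := Num.max _ _.
have mle1 : m <= 1.
  by rewrite ge_max !(le_trans (dist_le _ _ lb _) llb)//; case: Elb.
have m_ge0 : 0 <= m.
  rewrite le_max; apply/orP; left; apply: lb_le_inf.
    by exists `|l - 0|, 0.
  by move=> _ [b _ <-].
(* Near-minimizers of both distances are taken with slack [tau], which then tends to 0. *)
suff step tau : 0 < tau -> tau <= 1 ->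
    Defs.dist l (Emap g K x eta) <= c * (m + tau).
  apply/ler_addgt0Pr => eps eps0.
  have t0 : 0 < Num.min 1 (eps / c) by rewrite lt_min ltr01 divr_gt0.
  apply: le_trans (step _ t0 _) _; first by rewrite ge_min lexx.
  rewrite mulrDr lerD2l mulrC -ler_pdivlMr// ge_min lexx orbT //.
move=> tau0 tau1; set m' := m + tau.
have m'0 : 0 < m' by rewrite ltr_wpDl.
have m'2 : m' <= 2 by rewrite /m'; lra.
have [||n Nn ln] := dist_lt_exists N l m'.
- by exists 0.
- by rewrite (@le_lt_trans _ _ m)// ?ltrDl// le_max lexx.
have [||h Hh lh] := dist_lt_exists (Hmap g x eta) l m'.
- by exists m0.
- by rewrite (@le_lt_trans _ _ m)// ?ltrDl// le_max lexx orbT.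
have Lnm : L (n - m0) by rewrite addrC -scaleN1r; apply: LP; exact: subL.
have [v [Lv Av vle]] := hC _ Lnm.
have Ah : A h = A m0.
  apply: (@addrI _ eta); rewrite Hm0; exact: Hh.
pose S := k * m'; have S0 : 0 < S by rewrite mulr_gt0.
have vS : `|v| <= S.
  rewrite (le_trans vle)// (_ : S = C * (CA * (2 * m'))); last by rewrite /S /k; ring.
  rewrite ler_pM2l//.
  have -> : A (n - m0) = A (n - h) by rewrite !AD !AN Ah.
  rewrite (le_trans (hCA _))// ler_pM2l//.
  rewrite (_ : n - h = (l - h) - (l - n)); last first.
    by apply: inner_inj => z; rewrite !innerE; ring.
  by rewrite (le_trans (ler_normB _ _))//; lra.
(* The weight solves [t * (e / 2 / S) = 1 - t], so that [w] below equals
   [(1 - t) *: (n - v) + t *: m0], which satisfies the linear equation. It is also a convex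
   combination of [n] and [q], where [q] is in [N] because it moves [m0] by at most [e / 2] inside
   the affine hull. *)
pose t := S / (S + e / 2).
have Se : 0 < S + e / 2 by rewrite addr_gt0// divr_gt0.
have t0 : 0 < t by rewrite divr_gt0.
have t1 : t <= 1 by rewrite ler_pdivrMr// mul1r lerDl divr_ge0// ltW.
pose q := m0 - ((e / 2) / S) *: v.
have qe : `|m0 - q| <= e / 2.
  rewrite opprB addrC subrK normrZ ger0_norm; last by rewrite !divr_ge0// ltW.
  by rewrite mulrAC ler_pdivrMr// ler_pM2l// divr_gt0.
have Nq : N q.
  apply: he; split.
    rewrite -ball_normE /ball_ /=; lra.
  by rewrite /q addrC -scaleNr; apply: LP => //; exact: subL.
pose w := (1 - t) *: n + t *: q.
have Ew : Emap g K x eta w.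
  split; last by apply: normal_cone_comb => //; [rewrite subr_ge0|exact: ltW].
  rewrite /Hmap /= -/A /w /q AD !AZ AD AN AZ Av AD AN -[RHS]Hm0; congr (_ + _).
  have tE : t * (e / 2 / S) = 1 - t.
    by rewrite /t; field; rewrite ?gt_eqF//; lra.
  apply: inner_inj => z; rewrite !innerE.
  rewrite mulrDr mulrN mulrA tE; ring.
rewrite (le_trans (dist_le _ _ _ Ew))//.
have -> : l - w = (l - n) + t *: (n - q).
  by apply: inner_inj => z; rewrite /w !innerE; ring.
rewrite (le_trans (ler_normD _ _))// normrZ gtr0_norm//.
have tS : t <= 2 * S / e.
  rewrite ler_pdivrMr// (_ : 2 * S / e * (S + e / 2) = S + 2 * S * S / e).
    by rewrite lerDl divr_ge0 ?ltW// !mulr_gt0.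
  by field; rewrite gt_eqF.
have nM : `|n - q| <= M.
  have h1 : `|q| <= `|m0| + e.
    rewrite -(subrKC m0 q) (le_trans (ler_normD _ _))// lerD2l distrC.
    by apply: le_trans qe _; lra.
  have h2 : `|n| <= `|lb| + 3.
    rewrite (_ : n = lb + (l - lb) - (l - n)); last first.
      by apply: inner_inj => z; rewrite !innerE; ring.
    rewrite (le_trans (ler_normB _ _))//.
    have := ler_normD lb (l - lb); lra.
  by have := ler_normB n q; rewrite /M; lra.
rewrite /c mulrDl mul1r lerD//; first exact: ltW.
rewrite (_ : _ * m' = (2 * S / e) * M); last by rewrite /S; ring.
by rewrite ler_pM// ltW.
Qed.

(** * Differentials and first-order conditions *)

Lemma differentiable_remainder {R : realType} {V W : normedModType R}
    (h : V -> W) (x : V) (e : R) : differentiable h x -> 0 < e ->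
  exists2 d : R, 0 < d &
    forall u, `|u| < d -> `|h (x + u) - h x - 'd h x u| <= e * `|u|.
Proof.
move=> /diff_locally /eqaddoP H e0; have /nbhs_ballP[d d0 hd] := H _ e0.
exists d => // u ud; have := hd u; rewrite -ball_normE /= sub0r normrN => /(_ ud).
by rewrite /= !fctE /= opprD addrA (addrC u).
Qed.

Lemma differentiable_lipschitz_near {R : realType} {V : euclideanType R}
    {W : normedModType R} (h : V -> W) (x : V) : differentiable h x ->
  exists2 C : R, 0 < C & \forall z \near x, `|h z - h x| <= C * `|z - x|.
Proof.
move=> dh; have [d d0 hd] := differentiable_remainder h x 1 dh ltr01.
have [C C0 hC] := linear_bound ('d h x) (fun a u v => linearP _ a u v).
exists (C + 1); first by rewrite addr_gt0.
apply/nbhs_ballP; exists d => // z; rewrite -ball_normE /= distrC => zd.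
have := hd _ zd; rewrite subrKC mulrDl => h1.
rewrite -(subrK ('d h x (z - x)) (h z - h x)).
by rewrite (le_trans (ler_normD _ _))// addrC lerD.
Qed.

(** Finitely many basis directions share a neighbourhood; expanding [v] in coordinates makes the
    bound uniform in [v]. *)
Lemma diff_lipschitz_near {R : realType} {Y Z : euclideanType R} (h : Y -> Z)
    (x : Y) : (forall v, differentiable (fun z => 'd h z v) x) ->
  exists2 C : R, 0 < C & \forall z \near x,
    forall v, `|'d h z v - 'd h x v| <= C * `|z - x| * `|v|.
Proof.
move=> dh; pose b := vbasis {:Y}.
have /choice[c hc] i : exists c : R, forall v : Y, `|coord b i v : R^o| <= c * `|v|.
  by have [|c _ hc] := linear_bound (coord b i : Y -> R^o);
    [move=> a u v; rewrite linearP|exists c].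
have /choice[C hC] (i : 'I_(\dim {:Y})) : exists C : R, 0 < C /\
    \forall z \near x, `|'d h z b`_i - 'd h x b`_i| <= C * `|z - x|.
  by have [C C0 hC] := differentiable_lipschitz_near _ _ (dh b`_i); exists C.
have c_ge0 i : 0 <= `|c i| by [].
exists (1 + \sum_i `|c i| * C i).
  by rewrite ltr_pwDl// sumr_ge0// => i _; rewrite mulr_ge0// ltW//; case: (hC i).
have := @filter_forall _ _ (fun (i : 'I_(\dim {:Y})) z => `|'d h z b`_i - 'd h x b`_i| <= C i * `|z - x|)
  (nbhs x) (nbhs_filter x) (fun i => (hC i).2).
apply: filterS => z hz v.
have lin : linear (fun v => 'd h z v - 'd h x v).
  move=> a u w; rewrite (linearP ('d h z)) (linearP ('d h x)).
  by apply: inner_inj => t; rewrite !innerE; ring.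
rewrite (linear_coord _ lin) (le_trans (ler_norm_sum _ _ _))//.
rewrite !mulrDl mul1r ler_wpDl ?mulr_ge0// !mulr_suml ler_sum// => i _.
have h1 : `|coord b i v| <= `|c i| * `|v|.
  by rewrite (le_trans (hc _ _))// ler_wpM2r// ler_norm.
rewrite normrZ (le_trans (ler_pM _ _ h1 (hz i)))//.
by rewrite (_ : _ * _ * _ * _ = `|c i| * `|v| * (C i * `|z - x|))//; ring.
Qed.

Lemma norm_le_inner {R : realType} {X : euclideanType R} (u : X) (c : R) :
  0 <= c -> (forall v, inner u v <= c * `|v|) -> `|u| <= c.
Proof.
move=> c0 /(_ u); rewrite -sqr_norm_inner.
have [->|u0] := eqVneq u 0; first by rewrite normr0.
by rewrite expr2 ler_pM2r// normr_gt0.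
Qed.

Lemma dist_attained {R : realType} {X : euclideanType R} (A : set X) (x : X) :
  A !=set0 -> closed A -> Defs.dist x A = `|x - Defs.proj A x|.
Proof.
move=> A0 cA; have [Ap hp] := projP _ x A0 cA.
apply/eqP; rewrite eq_le dist_le//= lb_le_inf//.
  by exists `|x - Defs.proj A x|, (Defs.proj A x).
by move=> _ [q Aq <-]; exact: hp.
Qed.

Lemma dist_continuous {R : realType} {X : euclideanType R} (A : set X) :
  A !=set0 -> closed A -> continuous (fun x => Defs.dist x A : R^o).
Proof.
move=> A0 cA; apply: (@lipschitz_bound_continuous _ _ _ _ 1).
have h x y : Defs.dist x A - Defs.dist y A <= `|x - y|.
  rewrite (dist_attained _ y)// lerBlDr.
  have [Ap _] := projP _ y A0 cA; rewrite (le_trans (dist_le _ _ _ Ap))//.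
  by rewrite (le_trans _ (ler_normD _ _))// addrA subrK.
by move=> x y; rewrite mul1r ler_norml h andbT lerNl opprB distrC h.
Qed.

(** * Penalization and approximate multipliers *)

(** First-order condition with the target [p] frozen, so that only [h] is differentiated and not the
    distance to a cone. *)
Lemma penalized_minimum_directional {R : realType} {Y Z : euclideanType R}
    (h : Y -> Z) (a v w z : Y) (p : Z) (k r : R) :
  0 < r -> 0 <= k -> differentiable h z ->
  (forall u, `|u| <= r ->
    inner a w + `|w| ^+ 2 / 2 + k / 2 * `|h z - p| ^+ 2 <=
    inner a (w + u) + `|w + u| ^+ 2 / 2 + k / 2 * `|h (z + u) - p| ^+ 2) ->
  0 <= inner (a + w) v + inner (k *: (h z - p)) ('d h z v).
Proof.
move=> r0 k0 dh hmin; rewrite leNgt; apply/negP.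
set mu := k *: _; set G := 'd h z v; set s := _ + _ => s0.
(* With this [e], the remainder of [h] contributes at most [t * (- s / 2)] along [t *: v]. *)
pose e := - s / 2 / (`|mu| * `|v| + 1).
have muv : 0 < `|mu| * `|v| + 1 by rewrite ltr_wpDl ?mulr_ge0.
have e0 : 0 < e by rewrite !divr_gt0// oppr_gt0.
have [d d0 hd] := differentiable_remainder _ _ _ dh e0.
pose Q := `|v| ^+ 2 / 2 + k / 2 * (`|G| + e * `|v|) ^+ 2.
have Q0 : 0 <= Q.
  by rewrite addr_ge0 ?mulr_ge0 ?exprn_ge0 ?divr_ge0// addr_ge0// mulr_ge0// ltW.
pose m := Num.min d r; have m0 : 0 < m by rewrite lt_min d0 r0.
(* The second bound limits the quadratic terms [t ^+ 2 * Q] to [t * (- s / 4)]; the total variation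
   is then at most [t * s / 4 < 0]. *)
pose t := Num.min (m / (2 * (`|v| + 1))) (- s / 4 / (Q + 1)).
have v1 : 0 < `|v| + 1 by rewrite ltr_wpDl.
have Q1 : 0 < Q + 1 by rewrite ltr_wpDl.
have t0 : 0 < t by rewrite lt_min !divr_gt0 ?mulr_gt0// oppr_gt0.
have tv : `|t *: v| < m.
  rewrite normrZ gtr0_norm//.
  have : t <= m / (2 * (`|v| + 1)) by rewrite ge_min lexx.
  rewrite ler_pdivlMr ?mulr_gt0//; have := mulr_ge0 (ltW t0) (normr_ge0 v).
  by nra.
have tQ : t * Q <= - s / 4.
  have : t <= - s / 4 / (Q + 1) by rewrite ge_min lexx orbT.
  by rewrite ler_pdivlMr//; nra.
have /andP[td tr] : (`|t *: v| < d) && (`|t *: v| < r) by rewrite -lt_min.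
have {hd} := hd _ td; set rem := _ - _ - _ => hrem.
have hE : h (z + t *: v) - p = (h z - p) + (t *: G + rem).
  rewrite /rem linearZ /= -/G.
  by apply: inner_inj => x; rewrite !innerE; ring.
have {hmin} := hmin _ (ltW tr); rewrite hE (normD_sqr w) (normD_sqr (h z - p)).
have tGrem : `|t *: G + rem| <= t * (`|G| + e * `|v|).
  rewrite (le_trans (ler_normD _ _))// mulrDr lerD ?normrZ ?gtr0_norm//.
  by rewrite (le_trans hrem)// normrZ gtr0_norm// mulrCA.
have tGrem2 : `|t *: G + rem| ^+ 2 <= t ^+ 2 * (`|G| + e * `|v|) ^+ 2.
  rewrite -exprMn lerXn2r ?nnegrE//.
  by rewrite mulr_ge0 ?(ltW t0)// addr_ge0// mulr_ge0// ltW.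
have murem : inner mu rem <= t * (- s / 2).
  rewrite (le_trans (inner_le_norm _ _))//.
  rewrite (le_trans (ler_wpM2l (normr_ge0 _) hrem))// (normrZ t v) gtr0_norm//.
  have eE : e * (`|mu| * `|v| + 1) = - s / 2 by rewrite divfK ?gt_eqF.
  rewrite -eE (_ : t * (e * (`|mu| * `|v| + 1)) = `|mu| * (e * (t * `|v|)) + t * e); last by ring.
  by rewrite lerDl mulr_ge0// ltW.
have muE : k * inner (h z - p) (t *: G + rem) = t * inner mu G + inner mu rem.
  by rewrite /mu !innerE; ring.
have sE : s = inner a v + inner w v + inner mu G by rewrite /s innerDl.
rewrite innerDr innerZr innerZr (normrZ t v) gtr0_norm// exprMn => hh.
have {hh} : 0 <= t * s + inner mu rem + t ^+ 2 * Q.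
  have : k / 2 * `|t *: G + rem| ^+ 2 <= k / 2 * (t ^+ 2 * (`|G| + e * `|v|) ^+ 2).
    by rewrite ler_wpM2l// divr_ge0.
  rewrite sE /Q; lra.
have : t ^+ 2 * Q <= t * (- s / 4) by rewrite expr2 -mulrA ler_pM2l.
have : t * s < 0 by rewrite pmulr_rlt0.
by lra.
Qed.

(** A convex cone is closed under addition, so the variational inequality may be tested at
    [p + d]. *)
Lemma cone_projection_polar {R : realType} {Z : euclideanType R} (D : set Z)
    (x d : Z) : pointed_closed_convex_cone D -> D d ->
  inner (x - Defs.proj D x) d <= 0.
Proof.
move=> [DZ cvD clD _] Dd; have D0 : D !=set0 by exists d.
have [Dp hp] := projP _ x D0 clD; set p := Defs.proj D x in Dp hp *.
have Dpd : D (p + d).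
  have := convex_setP _ _ _ 2^-1 cvD (DZ 2 _ (ler0n _ 2) Dp) (DZ 2 _ (ler0n _ 2) Dd).
  rewrite invr_ge0 ler0n invf_le1// ler1n => /(_ isT isT); congr D.
  by apply: inner_inj => z; rewrite !innerE; field.
by have := nearest_point_le0 _ _ _ _ cvD Dp hp Dpd; rewrite addrAC subrr add0r.
Qed.

(** The defect of the multiplier rule is exactly [inner (z - y) v], coming from the quadratic term,
    so confining [z] to a ball of radius at most [e] controls both errors. *)
Lemma approximate_multiplier {R : realType} {Y Z : euclideanType R}
    (K U : set Y) (D : set Z) (h : Y -> Z) (y l : Y) (e : R) :
  open U -> U y -> pointed_closed_convex_cone D ->
  (forall z, U z -> differentiable h z) ->
  K `&` U = [set z | U z /\ D (h z)] -> normal_cone K y l -> 0 < e ->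
  exists z mu, [/\ U z, `|z - y| <= e, forall d, D d -> inner mu d <= 0 &
    forall v, `|inner l v - inner mu ('d h z v)| <= e * `|v|].
Proof.
move=> oU Uy coneD dh KU [Ky Nl] e0; have [_ cvD clD _] := coneD.
have KUE z : U z -> K z <-> D (h z).
  move=> Uz; have := congr1 (fun A : set Y => A z) KU => /= E.
  split=> [Kz|Dz].
    by have [] : U z /\ D (h z) by rewrite -E.
  by have [] : K z /\ U z by rewrite E.
have Dhy : D (h y) by apply/KUE.
have D0 : D !=set0 by exists (h y).
have /nbhs_ballP[r1 /= r10 r1U] : nbhs y U by exact: open_nbhs_nbhs.
pose r := Num.min (r1 / 2) e.
have r0 : 0 < r by rewrite lt_min divr_gt0.
have re : r <= e by rewrite ge_min lexx orbT.
have rr1 : r < r1.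
  by rewrite (@le_lt_trans _ _ (r1 / 2))// ?ge_min ?lexx//; lra.
pose B : set Y := [set z | `|y - z| <= r].
have BU z : B z -> U z.
  by move=> Bz; apply: r1U; rewrite -ball_normE /ball_ /= (le_lt_trans _ rr1).
have cB : compact B := compact_closed_ball_ y r.
pose d z : R^o := Defs.dist (h z) D.
have cd z : B z -> {for z, continuous d}.
  move=> Bz; apply: (@continuous_comp _ _ _ h (fun x => Defs.dist x D : R^o)).
    by apply: differentiable_continuous; apply: dh; exact: BU.
  exact: dist_continuous.
have cl z : {for z, continuous (fun z => inner l (z - y) : R^o)}.
  apply: (@continuous_comp _ _ _ (fun z => z - y) (fun z => inner l z : R^o)).
    by apply: continuousB; [exact: cvg_id|exact: cst_continuous].
  exact: inner_continuous.
have cn z : {for z, continuous (fun z => `|z - y| : R^o)}.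
  apply: (@continuous_comp _ _ _ (fun z => z - y) (fun z => `|z| : R^o)).
    by apply: continuousB; [exact: cvg_id|exact: cst_continuous].
  exact: norm_continuous.
have csqr (f : Y -> R^o) z : {for z, continuous f} ->
    {for z, continuous (fun z => f z ^+ 2 : R^o)}.
  move=> cf; apply: (@continuous_comp _ _ _ f (fun x : R^o => x ^+ 2 : R^o)) => //.
  exact: exprn_continuous.
have d_ge0 z : 0 <= d z by rewrite /d dist_attained.
have d_eq0 z : d z = 0 -> D (h z).
  rewrite /d dist_attained// => /eqP; rewrite normr_eq0 subr_eq0 => /eqP ->.
  by have [] := projP _ (h z) D0 clD.
(* phi k penalizes the constraint h z in D; the quadratic term makes y its only
   minimizer in the limit k -> oo, so for k large the minimizer over the closed
   ball B is interior, and mu is the gradient of the penalty there. *)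
pose phi (k : R) z : R^o :=
  - inner l (z - y) + `|z - y| ^+ 2 / 2 + k / 2 * d z ^+ 2.
have [k k0 hk] : exists2 k : R, 0 < k &
    forall z, `|y - z| = r -> 0 < phi k z.
  pose S := B `&` ~` ball y r.
  have cS : compact S.
    by apply: compact_closedI => //; exact: open_closedC (ball_open _ _).
  have SE z : `|y - z| = r -> S z.
    by move=> yz; split; rewrite /B /= ?yz// -ball_normE /ball_ /= yz ltxx.
  have [S0|/set0P/negP/negPn/eqP S0] := pselect (S !=set0); last first.
    by exists 1 => // z /SE; rewrite S0.
  (* Positive on the sphere: where [d z = 0] the point is in [K], so normality of [l] gives
     [inner l (z - y) <= 0 < r ^+ 2 / 2]. Compactness makes the bound uniform. *)
  pose m z : R^o := Num.max (r ^+ 2 / 2 - inner l (z - y) : R^o) (d z ^+ 2 : R^o).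
  have cm : {in S, continuous m}.
    move=> z; rewrite inE => -[Bz _]; 
    apply: (@continuous_max _ _ (fun z => r ^+ 2 / 2 - inner l (z - y)) (fun z => d z ^+ 2) z);
      last exact/csqr/cd.
    apply: (@continuousB _ R^o); [exact: cst_continuous|exact: cl].
  have [c] := compact_EVT_min S0 cS (continuous_in_subspaceT cm).
  rewrite inE => -[Bc /= rc] hc.
  have {}rc : r <= `|y - c|.
    by rewrite leNgt; apply/negP => H; apply: rc; rewrite -ball_normE.
  have mc0 : 0 < m c.
    rewrite ltNge; apply/negP; rewrite ge_max subr_le0 => /andP[rl dc].
    have /d_eq0/(KUE _ (BU _ Bc))/Nl : d c = 0.
      by apply/eqP; rewrite -sqrf_eq0 eq_le dc sqr_ge0.
    by have := exprn_gt0 2 r0; lra.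
  (* Where [d z ^+ 2 >= m c], the penalty is at least [|l| * r + 1] and outweighs the linear
     term. *)
  exists (2 * (`|l| * r + 1) / m c).
    by rewrite divr_gt0// mulr_gt0// ltr_wpDl// mulr_ge0// ltW.
  move=> z yz; have Sz := SE _ yz; have := hc z; rewrite !inE => /(_ Sz).
  rewrite /phi (distrC z y) yz {2}/m le_max => /orP[h1|h1].
    have := exprn_ge0 2 (d_ge0 z); rewrite -(pmulr_rge0 _ (_ : 0 < 2 * (`|l| * r + 1) / m c / 2)); last first.
      by rewrite !divr_gt0// mulr_gt0// ltr_wpDl// mulr_ge0// ltW.
    by move: mc0 h1; set q := m c; lra.
  have h2 : `|l| * r + 1 <= 2 * (`|l| * r + 1) / m c / 2 * d z ^+ 2.
    rewrite (_ : _ / 2 = (`|l| * r + 1) / m c); last by field; rewrite gt_eqF.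
    by rewrite mulrAC ler_pdivlMr// ler_wpM2l// addr_ge0// mulr_ge0// ltW.
  have := inner_le_norm l (z - y); rewrite distrC yz.
  by have := exprn_ge0 2 (ltW r0); lra.
have y0 : phi k y = 0.
  have dy0 : d y = 0.
    apply/eqP; rewrite eq_le d_ge0 andbT.
    by rewrite (le_trans (dist_le _ _ _ Dhy))// subrr normr0.
  by rewrite /phi dy0 subrr inner0r normr0 expr0n /= oppr0 mul0r mulr0 !addr0.
have [||z0] := @compact_EVT_min _ R (phi k) B _ cB.
- by exists y; rewrite /B /= subrr normr0 ltW.
- apply: continuous_in_subspaceT => z; rewrite inE => Bz.
  exact: (cvgD (cvgD (cvgN (cl z)) (cvgM (csqr _ _ (cn z)) (cvg_cst _)))
    (cvgM (cvg_cst _) (csqr _ _ (cd _ Bz)))).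
rewrite inE => Bz0 hmin.
have z0r : `|y - z0| < r.
  rewrite lt_neqAle [_ <= _]Bz0 andbT; apply/eqP => yz.
  have := hmin y; rewrite inE y0 leNgt hk// => H.
  by have := H; rewrite /B /= subrr normr0 (ltW r0) => /(_ isT).
pose p := Defs.proj D (h z0).
pose mu := k *: (h z0 - p).
(* The distance to [D] is at most the distance to [p], with equality at [z0], so [z0] still
   minimizes locally once [p] is frozen. *)
have dir v : 0 <= inner (- l + (z0 - y)) v + inner mu ('d h z0 v).
  apply: (@penalized_minimum_directional _ _ _ h (- l) v (z0 - y) z0 p k
    (r - `|y - z0|)) => //.
  - by rewrite subr_gt0.
  - exact: ltW.
  - by apply: dh; exact: BU.
  move=> u ur.
  have Bu : B (z0 + u).
    rewrite /B /= opprD addrA (le_trans (ler_normB _ _))//; lra.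
  have := hmin (z0 + u); rewrite inE => /(_ Bu); rewrite /phi /d.
  rewrite (dist_attained _ (h z0))// -/p => h1.
  have h2 : Defs.dist (h (z0 + u)) D <= `|h (z0 + u) - p|.
    by apply: dist_le; have [] := projP _ (h z0) D0 clD.
  have h3 : k / 2 * Defs.dist (h (z0 + u)) D ^+ 2 <=
      k / 2 * `|h (z0 + u) - p| ^+ 2.
    apply: ler_wpM2l; first by rewrite divr_ge0// ltW.
    by rewrite lerXn2r ?nnegrE//; exact: d_ge0.
  by rewrite !innerNl (addrAC z0 (- y)); apply: le_trans h1 _; rewrite lerD2l.
exists z0, mu; split.
- exact: BU.
- by rewrite distrC (le_trans (ltW z0r)).
- move=> x Dx; rewrite /mu innerZl.
  by apply: mulr_ge0_le0; [exact: ltW|exact: cone_projection_polar].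
(* The inequalities for [v] and [- v] together give equality. *)
move=> v; have -> : inner l v - inner mu ('d h z0 v) = inner (z0 - y) v.
  have := dir v; have := dir (- v).
  rewrite !innerDl !innerNl !innerNr (linearN ('d h z0)) innerNr.
  lra.
by rewrite (le_trans (normr_inner_le _ _))// ler_wpM2r// distrC (le_trans (ltW z0r)).
Qed.

(** If [z] in [K] violated the inequality, a short step from [y] towards [z] would stay in [K] and
    [U], yet [mu] would be positive on its image in [D], whose first-order part is
    [t *: 'd h y v]. *)
Lemma normal_cone_pullback {R : realType} {Y Z : euclideanType R}
    (K U : set Y) (D : set Z) (h : Y -> Z) (y : Y) (mu : Z) :
  convex_set K -> K y -> open U -> U y -> differentiable h y -> h y = 0 ->
  K `&` U = [set z | U z /\ D (h z)] -> (forall d, D d -> inner mu d <= 0) ->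
  normal_cone K y (adjoint ('d h y) mu).
Proof.
move=> cvK Ky oU Uy dh hy0 KU Dmu; split => // z Kz.
rewrite adjointE; last exact: linearP.
set v := z - y; set s := inner mu _; rewrite leNgt; apply/negP => s0.
(* Keeps the remainder, paired with [mu], below half of the leading term [t * s]. *)
pose e := s / 2 / (`|mu| * `|v| + 1).
have muv : 0 < `|mu| * `|v| + 1 by rewrite ltr_wpDl ?mulr_ge0.
have e0 : 0 < e by rewrite !divr_gt0.
have [d d0 hd] := differentiable_remainder _ _ _ dh e0.
have /nbhs_ballP[r /= r0 rU] : nbhs y U by exact: open_nbhs_nbhs.
have v1 : 0 < `|v| + 1 by rewrite ltr_wpDl.
pose m := Num.min d r; have m0 : 0 < m by rewrite lt_min d0 r0.
pose t := Num.min 1 (m / (2 * (`|v| + 1))).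
have t0 : 0 < t by rewrite lt_min ltr01 divr_gt0 ?mulr_gt0.
have t1 : t <= 1 by rewrite ge_min lexx.
have tv : `|t *: v| < m.
  rewrite normrZ gtr0_norm//.
  have : t <= m / (2 * (`|v| + 1)) by rewrite ge_min lexx orbT.
  rewrite ler_pdivlMr ?mulr_gt0//; have := mulr_ge0 (ltW t0) (normr_ge0 v).
  by nra.
have /andP[td tr] : (`|t *: v| < d) && (`|t *: v| < r) by rewrite -lt_min.
have Utv : U (y + t *: v).
  by apply: rU; rewrite -ball_normE /ball_ /= opprD addNKr normrN.
have Ktv : K (y + t *: v) by apply: convex_setP => //; exact: ltW.
have [_ Dtv] : [set z | U z /\ D (h z)] (y + t *: v) by rewrite -KU.
have := Dmu _ Dtv; have := hd _ td; rewrite hy0 subr0.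
set rem := h _ - _ => hrem.
have -> : h (y + t *: v) = t *: 'd h y v + rem by rewrite /rem linearZ subrKC.
rewrite innerDr innerZr -/s leNgt => /negP; apply.
have : - inner mu rem <= `|mu| * (e * `|t *: v|).
  rewrite -innerNr (le_trans (inner_le_norm _ _))// normrN.
  by rewrite ler_wpM2l.
rewrite (normrZ t v) gtr0_norm// => h1.
have h2 : `|mu| * (e * (t * `|v|)) <= t * (s / 2).
  have eE : e * (`|mu| * `|v| + 1) = s / 2 by rewrite divfK ?gt_eqF.
  rewrite -eE (_ : t * (e * (`|mu| * `|v| + 1)) =
    `|mu| * (e * (t * `|v|)) + t * e); last by ring.
  by rewrite lerDl mulr_ge0// ltW.
have := mulr_gt0 t0 s0; lra.
Qed.

(** * Calmness of the normal cone map and transfer to [Gmap] *)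

Lemma normal_cone_calm {R : realType} {Y : euclideanType R} (K : set Y)
    (yb : Y) : convex_set K -> K yb -> C2_cone_reducible_at K yb ->
  exists M rho : R, [/\ 0 < M, 0 < rho & forall y l, `|y - yb| <= rho ->
    normal_cone K y l -> exists l', normal_cone K yb l' /\
      `|l - l'| <= M * (1 + `|l|) * `|y - yb|].
Proof.
move=> cvK Kyb [U [Z [D [h [[oU Uyb] coneD hC2 [hyb hsurj] KU]]]]].
have dh z : U z -> differentiable h z by move=> /hC2[].
have [_ ddh _] := hC2 _ Uyb.
have [L L0 hL] := diff_lipschitz_near _ _ ddh.
have [||b b0 hb] := linear_bounded_section ('d h yb) setT (fun a u v => linearP _ a u v).
- by [].
- by [].
have /nbhs_ballP[d /= d0 hd] : \forall z \near yb, U z /\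
    forall v, `|'d h z v - 'd h yb v| <= L * `|z - yb| * `|v|.
  near=> z; split; last by near: z.
  by near: z; exact: open_nbhs_nbhs.
(* [d / 4] keeps [z], at distance up to [2 * e] from [yb], in the Lipschitz neighbourhood; the last
   bound lets the term in [|mu|] be absorbed when [|mu|] is estimated. *)
pose rho := Num.min 1 (Num.min (d / 4) (1 / (4 * (b * L)))).
have bL : 0 < b * L by rewrite mulr_gt0.
have rho0 : 0 < rho by rewrite !lt_min ltr01 !divr_gt0// mulr_gt0.
exists (1 + 4 * (b * L)), rho; split => //; first by rewrite addr_gt0// mulr_gt0.
move=> y l yrho Nl.
have [yE|yne] := eqVneq y yb.
  by exists l; rewrite -yE subrr normr0 !subrr !normr0 mulr0; split.
set e := `|y - yb| in yrho *.
have e0 : 0 < e by rewrite normr_gt0 subr_eq0.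
move: yrho; rewrite /rho !le_min => /and3P[e1 ed].
rewrite ler_pdivlMr ?mulr_gt0// => ebL.
have Uy : U y.
  by have [] := hd y; rewrite // -ball_normE /ball_ /= distrC -/e; lra.
(* The tolerance is [|y - yb|] itself, so the inexactness is of the order of the desired
   estimate. *)
have [z [mu [Uz zy Dmu hmu]]] :=
  approximate_multiplier _ _ _ _ _ _ _ oU Uy coneD dh KU Nl e0.
have zyb : `|z - yb| <= 2 * e.
  rewrite (_ : z - yb = (z - y) + (y - yb)); last by rewrite addrA subrK.
  by rewrite (le_trans (ler_normD _ _))// -/e; lra.
have [_ hz] : U z /\ forall v, `|'d h z v - 'd h yb v| <= L * `|z - yb| * `|v|.
  by apply: hd; rewrite -ball_normE /ball_ /= distrC; lra.
pose l' := adjoint ('d h yb) mu.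
have l'E v : inner l' v = inner mu ('d h yb v).
  by apply: adjointE; exact: linearP.
exists l'; split.
  by apply: normal_cone_pullback KU Dmu => //; exact: dh.
have ll' : `|l - l'| <= e + `|mu| * (L * (2 * e)).
  apply: norm_le_inner => [|v].
    by rewrite addr_ge0 ?mulr_ge0 ?(ltW e0) ?(ltW L0).
  rewrite innerDl innerNl l'E.
  have h1 := le_trans (ler_norm _) (hmu v).
  have h2 := le_trans (inner_le_norm mu ('d h z v - 'd h yb v))
    (ler_wpM2l (normr_ge0 mu) (hz v)).
  have h3 : `|mu| * (L * `|z - yb| * `|v|) <= `|mu| * (L * (2 * e)) * `|v|.
    by rewrite mulrA ler_wpM2r// ler_wpM2l// ler_pM2l.
  by move: h2; rewrite innerDr innerNr mulrDl; lra.
(* Choosing [w] with ['d h yb w = mu] and [|w| <= b * |mu|], one has [|mu| ^+ 2 = inner l' w], hence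
   [|mu| <= b * |l'|]. Replacing [l'] by [l] costs at most [|mu| / 2], which is absorbed. *)
have mub : `|mu| <= 2 * (b * (`|l| + e)).
  have [w0 _ w0E] : range ('d h yb) mu by rewrite hsurj.
  have [w [_ wE wle]] := hb w0 I; rewrite w0E in wE wle.
  have h1 : `|mu| <= b * `|l'|.
    have [->|mu0] := eqVneq mu 0; first by rewrite normr0 mulr_ge0// ltW.
    rewrite -(ler_pM2r (_ : 0 < `|mu|)) ?normr_gt0// -expr2 sqr_norm_inner.
    rewrite -{2}wE -l'E (le_trans (inner_le_norm _ _))// mulrAC mulrC.
    by rewrite ler_wpM2r.
  have h2 : `|l'| <= `|l| + `|l - l'|.
    by rewrite distrC -{1}(subrK l l') addrC ler_normD.
  have h3 : b * `|l'| <= b * (`|l| + (e + `|mu| * (L * (2 * e)))).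
    by rewrite ler_pM2l// (le_trans h2)// lerD2l.
  have h4 : `|mu| * (e * (4 * (b * L))) <= `|mu| * 1 by rewrite ler_wpM2l.
  lra.
rewrite (le_trans ll')//.
have h1 : `|mu| * (L * (2 * e)) <= 2 * (b * (`|l| + e)) * (L * (2 * e)).
  by rewrite ler_wpM2r// !mulr_ge0// ltW.
have h2 : 2 * (b * (`|l| + e)) * (L * (2 * e)) <= 4 * (b * L) * (1 + `|l|) * e.
  rewrite (_ : _ * (L * (2 * e)) = 4 * (b * L) * (`|l| + e) * e); last by ring.
  by rewrite ler_pM2r// ler_pM2l ?mulr_gt0// addrC lerD2r.
have h3 : 0 <= `|l| * e by rewrite mulr_ge0// ltW.
by rewrite mulrDl mul1r mulrDl mulrDl mul1r; lra.
Unshelve. all: by end_near. Qed.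

Lemma Emap_calm_Gmap_calm {R : realType} {X Y : euclideanType R} (g : X -> Y)
    (K : set Y) (xb eta : X) (lb : Y) : K !=set0 -> closed K -> convex_set K ->
  C2_cone_reducible_at K (g xb) ->
  calm (Emap g K xb) eta lb -> calm (Gmap g K xb) (eta, g xb) lb.
Proof.
move=> K0 clK cvK red [[Hlb Nlb] [kappa [eps0 [del0 [kappa0 eps00 del00 hE]]]]].
have EG u : Emap g K xb eta u -> Gmap g K xb (eta, g xb) u.
  move=> [Hu /(normal_cone_proj _ _ _ K0 clK cvK) Nu].
  by split => //=; apply/eqP; rewrite subr_eq0; apply/eqP.
split; first exact: EG.
have Ky : K (g xb) by case: Nlb.
have [M1 [rho [M10 rho0 hM]]] := normal_cone_calm _ _ cvK Ky red.
have lA := nabla_linear g xb; have [AD AN _] := linear_ops _ lA.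
have [CA CA0 hCA] := linear_bound _ lA.
(* Since [del <= 1], [|l| <= |lb| + 1], which removes the dependence on [l] from the estimate. *)
pose M := M1 * (`|lb| + 2).
have M0 : 0 < M by rewrite mulr_gt0// ltr_wpDl.
pose Q := CA * M + 1; have Q0 : 0 < Q by rewrite addr_gt0// mulr_gt0.
pose del := Num.min 1 (del0 / 2).
have del_gt0 : 0 < del by rewrite lt_min ltr01 divr_gt0.
(* The bounds make the normal cone estimate available, leave [l'] within [del0] of [lb] (half of it
   for [l - lb], half for [l - l']), and keep [eta'] within [eps0] of [eta]. *)
pose eps := Num.min rho (Num.min (del0 / 2 / M) (eps0 / Q)).
have eps_gt0 : 0 < eps by rewrite !lt_min rho0 !divr_gt0.
exists (M + kappa * Q), eps, del; split => //.
  by rewrite addr_gt0// mulr_gt0.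
move=> p; rewrite closed_ballE// /closed_ball_ /= distrC => ps l [[Hl Gl]].
rewrite closed_ballE// /closed_ball_ /= distrC => llb.
set s := `|p - (eta, g xb)| in ps *.
have s1 : `|p.1 - eta| <= s by rewrite /s prod_normE /= le_max lexx.
have s2 : `|p.2 - g xb| <= s by rewrite /s prod_normE /= le_max lexx orbT.
have s_ge0 : 0 <= s by exact: normr_ge0.
move: ps; rewrite !le_min => /and3P[srho].
rewrite !ler_pdivlMr// => sM sQ.
move: llb; rewrite le_min => /andP[llb1 llb2].
have Nl : normal_cone K p.2 l.
  by apply/normal_cone_proj => //; apply/eqP; rewrite -subr_eq0; apply/eqP.
have [l' [Nl' ll']] := hM _ _ (le_trans s2 srho) Nl.
have {}ll' : `|l - l'| <= M * s.
  rewrite (le_trans ll')// ler_pM// ?mulr_ge0 ?addr_ge0 ?(ltW M10)// ler_pM2l//.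
  have := ler_normD lb (l - lb); rewrite subrKC; lra.
(* The perturbation for which [l'] solves the linear equation, so that [l'] lies in
   [Emap g K xb eta']. *)
pose eta' := - nabla g xb l'.
have eta'E : `|eta' - eta| <= Q * s.
  rewrite (_ : eta' - eta = nabla g xb (l - l') + (p.1 - eta)); last first.
    rewrite AD AN /eta' -(addr0_eq Hl).
    by apply: inner_inj => z; rewrite !innerE; ring.
  rewrite (le_trans (ler_normD _ _))// /Q mulrDl mul1r lerD//.
  by rewrite (le_trans (hCA _))// -mulrA ler_pM2l.
have [||u Eu [b bB ub]] := hE eta' _ l'.
- rewrite closed_ballE// /closed_ball_ /= distrC (le_trans eta'E)// mulrC//.
- split; first by split => //; rewrite /Hmap /eta' /= addNr.
  rewrite closed_ballE// /closed_ball_ /= distrC.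
  rewrite (_ : l' - lb = (l - lb) - (l - l')); last first.
    by apply: inner_inj => z; rewrite !innerE; ring.
  rewrite (le_trans (ler_normB _ _))//; lra.
have lu : `|l - u| <= (M + kappa * Q) * s.
  rewrite (_ : l - u = (l - l') + (kappa * `|eta' - eta|) *: b); last first.
    by rewrite -ub; apply: inner_inj => z; rewrite !innerE; ring.
  rewrite (le_trans (ler_normD _ _))// mulrDl lerD// normrZ.
  rewrite ger0_norm ?mulr_ge0 ?(ltW kappa0)//.
  move: bB; rewrite closed_ballE// /closed_ball_ /= sub0r normrN => b1.
  rewrite -!mulrA ler_pM2l// -[leRHS]mulr1 ler_pM//.
have [c cB cE] := ball_decomposition _ _ _ lu.
by exists u; [exact: EG|exists c].
Qed.

Theorem proposition2p2 (R : realType) (X Y : euclideanType R)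
    (f : X -> R^o) (g : X -> Y) (K : set Y) (xb : X) (lb : Y)
    (f_C2 : twice_continuously_differentiable setT f)
    (g_C2 : twice_continuously_differentiable setT g)
    (K_neq0 : K !=set0) (K_closed : closed K) (K_convex : convex_set K)
    (K_reducible : C2_cone_reducible K)
    (kkt : KKT_point f g K xb lb) :
  let etab := grad f xb in
  let yb := g xb in
  [/\ calm (Emap g K xb) etab lb -> calm (Gmap g K xb) (etab, yb) lb,
      dist_bound g K xb etab lb -> calm (Emap g K xb) etab lb &
      rel_interior (normal_cone K yb) `&` Hmap g xb etab !=set0 ->
      dist_bound g K xb etab lb].
Proof.
move=> etab yb; have [Hlb Nlb] := kkt.
have Elb : Emap g K xb etab lb by split.
split; last exact: rel_interior_dist_bound.
  apply: Emap_calm_Gmap_calm => //; apply: K_reducible; by case: Nlb.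
exact: dist_bound_calm.
Qed.
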